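(* Let $m\in\mathbb{N}$ and let $n\le 2m$. Then the functional $\widetilde{\Phi}^{(m)}\circ j^{(m)}$ agrees with the conditionally free product $*_{i\in\{1,2\}}(\phi_i,\psi_i)$ on word products $w_1\ldots w_n$; that is, $$\left(\widetilde{\Phi}^{(m)}\circ j^{(m)}\right)(w_1\ldots w_n)=\left( *_{i\in\{1,2\}}(\phi_i,\psi_i)\right)(w_1\ldots w_n)$$ whenever $w_1,\ldots,w_n$ are words in $\mathcal{A}_{k_1},\ldots,\mathcal{A}_{k_n}$, respectively, with $k_1,\ldots,k_n\in\{1,2\}$ and $k_1\ne k_2\ne\cdots\ne k_n$ (consecutive indices different).
   Context: Algebras and states. For $l=1,2$, $\mathcal{A}_l$ is the unital free *-algebra over $\mathbb{C}$ generated by a set $\mathcal{G}_l^+$: with $\mathcal{G}_l^-=\{a^*: a\in\mathcal{G}_l^+\}$ and $\mathcal{G}_l=\mathcal{G}_l^+\cup\mathcal{G}_l^-$, it is the free unital algebra on the letters $\mathcal{G}_l$, with words $a_1\ldots a_k$ ($a_i\in\mathcal{G}_l$) as linear basis, the empty word being the unit $\mathbf{1}$, and involution the antilinear extension of $(a_1\ldots a_k)^*=a_k^*\ldots a_1^*$. A state on a unital *-algebra is a linear functional $\phi$ with $\phi(\mathbf{1})=1$ and $\phi(xx^* )\ge 0$ for all $x$. $\phi_l,\psi_l$ are states on $\mathcal{A}_l$. Boolean extension. $\widetilde{\mathcal{A}}_l=\mathcal{A}_l*\mathbb{C}[t]$ is the free product with units identified, $t=t^*$. For a state $\phi$ on $\mathcal{A}_l$,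 its Boolean extension $\widetilde{\phi}$ is the state on $\widetilde{\mathcal{A}}_l$ which is the linear extension of $\widetilde{\phi}(\mathbf{1})=1$ (more generally $\widetilde\phi(t^r)=1$) and $\widetilde{\phi}(t_0w_1t_1\ldots w_nt_n)=\phi(w_1)\ldots\phi(w_n)$, where $w_1,\ldots,w_n$ are non-empty words in $\mathcal{A}_l$ and $t_0,\ldots,t_n$ are powers of $t$, of which $t_1,\ldots,t_{n-1}\neq\mathbf{1}$. Tensor product space. $\widetilde{\mathcal{A}}^{(m)}=\widetilde{\mathcal{A}}_1^{\otimes m}\otimes\widetilde{\mathcal{A}}_2^{\otimes m}$ (algebraic tensor product, componentwise involution), with state $\widetilde{\Phi}^{(m)}=\widetilde{\phi}_1\otimes\widetilde{\psi}_1^{\otimes(m-1)}\otimes\widetilde{\phi}_2\otimes\widetilde{\psi}_2^{\otimes(m-1)}$. Put $I_k=\mathbf{1}^{\otimes k}$; for $x\in\widetilde{\mathcal{A}}_l$ and $1\le k\le m$ let $i_{k,m}(x)=I_{k-1}\otimes x\otimes I_{m-k}\in\widetilde{\mathcal{A}}_l^{\otimes m}$, with the convention $i_{m+1,m}(a)=0$; and $t_{[k,m]}=I_{k-1}\otimes t^{\otimes(m-k+1)}$. The homomorphism. For $a\in\mathcal{G}_1$, $b\in\mathcal{G}_2$, $$j_1^{(m)}(a)=\sum_{k=1}^m(i_{k,m}(a)-i_{k+1,m}(a))\otimes t_{[k,m]},\qquad j_2^{(m)}(b)=\sum_{k=1}^m t_{[k,m]}\otimes(i_{k,m}(b)-i_{k+1,m}(b)).$$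 $j^{(m)}:\mathcal{A}_1*\mathcal{A}_2\to\widetilde{\mathcal{A}}^{(m)}$ (free product with identified units) is the unital *-homomorphism with $j^{(m)}(a)=j_l^{(m)}(a)$ for $a\in\mathcal{G}_l$, $l=1,2$. Conditionally free product. $\phi=*_{i\in\{1,2\}}(\phi_i,\psi_i)$ is the state on $\mathcal{A}_1*\mathcal{A}_2$ determined by $\phi(\mathbf{1})=1$ and $\phi(a_1\ldots a_n)=\phi_{k_1}(a_1)\ldots\phi_{k_n}(a_n)$ whenever $a_j\in\mathcal{A}_{k_j}$, $\psi_{k_j}(a_j)=0$ and $k_1\ne k_2\ne\cdots\ne k_n$. *)

(* Defs.v *)
From HB Require Import structures.
From mathcomp Require Import all_boot all_order all_algebra.
From mathcomp Require Import finmap monalg.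

Set Implicit Arguments.
Unset Strict Implicit.
Unset Printing Implicit Defensive.

Import Order.TTheory GRing.Theory Num.Theory.

Local Open Scope ring_scope.

(* The monoid algebra of a direct product of monoids is the tensor product of
   their monoid algebras: the elementary tensors of basis elements form the
   basis and are multiplied componentwise. *)
Section ProductMonoids.

Variables (I : finType) (K K1 K2 : monomType).

Definition ffun_mone : {ffun I -> K} := [ffun=> mone].
Definition ffun_mmul (u v : {ffun I -> K}) : {ffun I -> K} :=
  [ffun i => mmul (u i) (v i)].

Lemma ffun_mmulA : associative ffun_mmul.
Proof. by move=> u v w; apply/ffunP=> i; rewrite !ffunE mulmA. Qed.

Lemma ffun_mmul1m : left_id ffun_mone ffun_mmul.
Proof. by move=> u; apply/ffunP=> i; rewrite !ffunE mul1m. Qed.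

Lemma ffun_mmulm1 : right_id ffun_mone ffun_mmul.
Proof. by move=> u; apply/ffunP=> i; rewrite !ffunE mulm1. Qed.

Lemma ffun_unitm u v :
  ffun_mmul u v = ffun_mone -> u = ffun_mone /\ v = ffun_mone.
Proof.
move=> /ffunP uv; have uv1 i : u i = mone /\ v i = mone.
  by apply: unitm; have:= uv i; rewrite !ffunE.
by split; apply/ffunP=> i; rewrite ffunE; case: (uv1 i).
Qed.

HB.instance Definition _ := Choice_isMonomialDef.Build {ffun I -> K}
  ffun_mmulA ffun_mmul1m ffun_mmulm1 ffun_unitm.

Definition pair_mone : K1 * K2 := (mone, mone).
Definition pair_mmul (u v : K1 * K2) : K1 * K2 :=
  (mmul u.1 v.1, mmul u.2 v.2).

Lemma pair_mmulA : associative pair_mmul.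
Proof. by move=> u v w; rewrite /pair_mmul /= !mulmA. Qed.

Lemma pair_mmul1m : left_id pair_mone pair_mmul.
Proof. by case=> u v; rewrite /pair_mmul /= !mul1m. Qed.

Lemma pair_mmulm1 : right_id pair_mone pair_mmul.
Proof. by case=> u v; rewrite /pair_mmul /= !mulm1. Qed.

Lemma pair_unitm u v :
  pair_mmul u v = pair_mone -> u = pair_mone /\ v = pair_mone.
Proof.
by case: u v => [u1 u2] [v1 v2] [/unitm[-> ->] /unitm[-> ->]].
Qed.

HB.instance Definition _ := Choice_isMonomialDef.Build (K1 * K2)%type
  pair_mmulA pair_mmul1m pair_mmulm1 pair_unitm.

End ProductMonoids.

Section MonoidAlgebras.

Variable C : numClosedFieldType.

Variables K K' : monomType.

(* Antilinear extension of [s] to the monoid algebra. *)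
Definition malg_star (s : K -> K) : {malg C[K]} -> {malg C[K]} :=
  mmap (@malgC K C \o Num.conj) (fun k => << s k >>).

Definition is_state (star : {malg C[K]} -> {malg C[K]})
    (phi : {scalar {malg C[K]}}) : Prop :=
  phi 1 = 1 /\ forall x, 0 <= phi (x * star x).

(* Linear extension of [h] to the monoid algebra. *)
Definition malg_ext (h : K -> {malg C[K']}) : {malg C[K]} -> {malg C[K']} :=
  mmap (@malgC K' C) h.

Definition tens (x : {malg C[K]}) (y : {malg C[K']}) :
  {malg C[(K * K')%type]} :=
  \sum_(u <- msupp x) \sum_(v <- msupp y) << x@_u * y@_v *g (u, v) >>.

End MonoidAlgebras.

(* The indices l = 1, 2 are encoded as the booleans false, true. *)
Section Letters.

Variable G : bool -> choiceType.

(* (g, false) is the generator g and (g, true) its adjoint. *)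
Definition letter (l : bool) : choiceType := (G l * bool)%type.

Definition letter_star (l : bool) (a : letter l) : letter l := (a.1, ~~ a.2).

(* [None] is the letter t. *)
Definition tletter (l : bool) : choiceType := option (letter l).

Definition tletter_star (l : bool) : tletter l -> tletter l :=
  omap (@letter_star l).

Definition fletter : choiceType := {l : bool & letter l}.

Definition fletter_star (x : fletter) : fletter :=
  Tagged letter (letter_star (tagged x)).

Definition word_star (X : choiceType) (s : X -> X) (w : {fmonom X}) :
  {fmonom X} := FMonom (rev (map s w)).

End Letters.

(* The unital free product of free algebras (here A_l with C[t], the free
   algebra on t, and A_1 with A_2) is the free algebra on the disjoint union of
   the alphabets. *)
Notation alg C G l := {malg C[{fmonom letter G l}]}.
Notation talg C G l := {malg C[{fmonom tletter G l}]}.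
Notation falg C G := {malg C[{fmonom fletter G}]}.

Notation tpow_monom G m l := {ffun 'I_m -> {fmonom tletter G l}}.
Notation tens_monom G m := (tpow_monom G m false * tpow_monom G m true)%type.
Notation talg_pow C G m l := {malg C[tpow_monom G m l]}.
Notation tens_alg C G m := {malg C[tens_monom G m]}.

Section Construction.

Variables (C : numClosedFieldType) (G : bool -> choiceType).

Definition alg_star (l : bool) : alg C G l -> alg C G l :=
  malg_star (word_star (@letter_star G l)).

Definition falg_star : falg C G -> falg C G :=
  malg_star (word_star (@fletter_star G)).

Definition tens_monom_star (m : nat) (p : tens_monom G m) : tens_monom G m :=
  ([ffun i => word_star (@tletter_star G false) (p.1 i)],
   [ffun i => word_star (@tletter_star G true) (p.2 i)]).

Definition tens_star (m : nat) : tens_alg C G m -> tens_alg C G m :=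
  malg_star (@tens_monom_star m).

Definition incl (l : bool) : alg C G l -> falg C G :=
  malg_ext (fun w : {fmonom letter G l} =>
    << FMonom (map (Tagged (letter G)) w) >>).

(* Cuts a word at each occurrence of t; consecutive cuts leave empty blocks. *)
Fixpoint blocks (X : Type) (s : seq (option X)) : seq (seq X) :=
  match s with
  | [::] => [:: [::]]
  | None :: s' => [::] :: blocks s'
  | Some a :: s' => (a :: head [::] (blocks s')) :: behead (blocks s')
  end.

Definition bool_ext_word (l : bool) (phi : alg C G l -> C)
    (w : {fmonom tletter G l}) : C :=
  \prod_(b <- blocks w | ~~ nilp b) phi << FMonom b >>.

Definition bool_ext (l : bool) (phi : alg C G l -> C) : talg C G l -> C :=
  mmap idfun (bool_ext_word phi).

Definition tens_state (m : nat) (phi psi : forall l, alg C G l -> C) :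
    tens_alg C G m -> C :=
  let st l (i : 'I_m) :=
    bool_ext (if i == 0%N :> nat then phi l else psi l) in
  mmap idfun (fun p : tens_monom G m =>
    (\prod_(i < m) st false i << p.1 i >>)
      * (\prod_(i < m) st true i << p.2 i >>)).

(* i_{k,m}, with k counted from 1 and i_{k,m} = 0 for k > m. *)
Definition tens_incl (l : bool) (m k : nat) (x : talg C G l) :
    talg_pow C G m l :=
  if (k <= m)%N then
    malg_ext (fun w =>
      << [ffun i : 'I_m => if i.+1 == k then w else mone] >>) x
  else 0.

(* t_{[k,m]}, with k counted from 1. *)
Definition tens_t (l : bool) (m k : nat) : talg_pow C G m l :=
  << [ffun i : 'I_m =>
       if (k <= i.+1)%N then fmu (None : tletter G l) else mone] >>.

Definition talg_letter (l : bool) (a : letter G l) : talg C G l :=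
  << fmu (Some a : tletter G l) >>.

Definition j1 (m : nat) (a : letter G false) : tens_alg C G m :=
  \sum_(1 <= k < m.+1)
    tens (tens_incl m k (talg_letter a) - tens_incl m k.+1 (talg_letter a))
         (tens_t true m k).

Definition j2 (m : nat) (b : letter G true) : tens_alg C G m :=
  \sum_(1 <= k < m.+1)
    tens (tens_t false m k)
         (tens_incl m k (talg_letter b) - tens_incl m k.+1 (talg_letter b)).

Definition j_letter (m : nat) (x : fletter G) : tens_alg C G m :=
  match x with
  | existT false a => j1 m a
  | existT true b => j2 m b
  end.

Definition j (m : nat) : falg C G -> tens_alg C G m :=
  malg_ext (fun w : {fmonom fletter G} => \prod_(x <- w) j_letter m x).

Definition alternating (n : nat) (k : 'I_n -> bool) : Prop :=
  forall i i' : 'I_n, i' = i.+1 :> nat -> k i != k i'.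

Definition cond_free_product (phi psi : forall l, alg C G l -> C)
    (chi : {scalar falg C G}) : Prop :=
  is_state falg_star chi /\
  forall (n : nat) (k : 'I_n -> bool) (a : forall i, alg C G (k i)),
    alternating k -> (forall i, psi (k i) (a i) = 0) ->
    chi (\prod_(i < n) incl (a i)) = \prod_(i < n) phi (k i) (a i).

End Construction.

Section MonoidAlgebraTheory.

Variable C : numClosedFieldType.

Lemma malg_ext0 (K K' : monomType) (h : K -> {malg C[K']}) :
  malg_ext h 0 = 0.
Proof. exact: mmap0. Qed.

Lemma malg_extD (K K' : monomType) (h : K -> {malg C[K']}) :
  {morph malg_ext h : x y / x + y}.
Proof. exact: mmapD. Qed.

Lemma malg_star0 (K : monomType) (s : K -> K) :
  malg_star s 0 = 0 :> {malg C[K]}.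
Proof. exact: mmap0. Qed.

Lemma malg_starD (K : monomType) (s : K -> K) :
  {morph @malg_star C K s : x y / x + y}.
Proof. exact: mmapD. Qed.

Lemma malg_starB (K : monomType) (s : K -> K) :
  {morph @malg_star C K s : x y / x - y}.
Proof. exact: mmapB. Qed.

Lemma malg_star_sum (K : monomType) (s : K -> K) I (r : seq I) (P : pred I)
    (F : I -> {malg C[K]}) :
  malg_star s (\sum_(i <- r | P i) F i) = \sum_(i <- r | P i) malg_star s (F i).
Proof. exact: (big_morph _ (malg_starD s) (malg_star0 s)). Qed.

Lemma malg_extU (K K' : monomType) (h : K -> {malg C[K']}) c k :
  malg_ext h << c *g k >> = c *: h k.
Proof. by rewrite /malg_ext mmapU mul_malgC. Qed.

Lemma malg_starU (K : monomType) (s : K -> K) (c : C) k :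
  malg_star s << c *g k >> = << c^* *g s k >>.
Proof.
rewrite /malg_star mmapU /= mul_malgC; apply/malgP=> k'.
by rewrite mcoeffZ !mcoeffU mulr_natr.
Qed.

Lemma malgUM (K : monomType) (c d : C) (k l : K) :
  << c *g k >> * << d *g l >> = << c * d *g mmul k l >> :> {malg C[K]}.
Proof. by rewrite malgM_def fgmulUU. Qed.

Lemma malg_ind (K : monomType) (P : {malg C[K]} -> Prop) :
  P 0 -> (forall x y, P x -> P y -> P (x + y)) ->
  (forall c k, P << c *g k >>) -> forall x, P x.
Proof. by move=> P0 PD PU x; rewrite [x]monalgE; elim/big_ind: _. Qed.

Lemma malg_extZ (K K' : monomType) (h : K -> {malg C[K']}) c x :
  malg_ext h (c *: x) = c *: malg_ext h x.
Proof.
elim/malg_ind: x => [|x y IHx IHy|d k]; first by rewrite !(scaler0, malg_ext0).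
  by rewrite scalerDr !malg_extD IHx IHy scalerDr.
by rewrite -mul_malgC malgUM mul1m !malg_extU scalerA.
Qed.

Lemma malg_mulZr (K : monomType) c (x y : {malg C[K]}) :
  x * (c *: y) = c *: (x * y).
Proof.
elim/malg_ind: x => [|x x' IHx IHx'|a k]; first by rewrite !(mul0r, scaler0).
  by rewrite !mulrDl IHx IHx' scalerDr.
elim/malg_ind: y => [|y y' IHy IHy'|b l]; first by rewrite !(mulr0, scaler0).
  by rewrite !(scalerDr, mulrDr) IHy IHy'.
by rewrite -!mul_malgC !malgUM mulmA mulm1 mul1m mulrCA.
Qed.

Lemma malg_extM (K K' : monomType) (h : K -> {malg C[K']}) :
  (forall k l, h (mmul k l) = h k * h l) -> {morph malg_ext h : x y / x * y}.
Proof.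
move=> hM x y.
elim/malg_ind: x => [|x x' IHx IHx'|a k]; first by rewrite !(mul0r, malg_ext0).
  by rewrite mulrDl !malg_extD mulrDl IHx IHx'.
elim/malg_ind: y => [|y y' IHy IHy'|b l]; first by rewrite !(mulr0, malg_ext0).
  by rewrite mulrDr !malg_extD mulrDr IHy IHy'.
by rewrite malgUM !malg_extU hM malg_mulZr -scalerAl scalerA mulrC.
Qed.

Lemma malg_starM (K : monomType) (s : K -> K) :
  (forall k l, s (mmul k l) = mmul (s l) (s k)) ->
  forall x y, malg_star s (x * y) = malg_star s y * malg_star s x :> {malg C[K]}.
Proof.
move=> sM x y.
elim/malg_ind: x => [|x x' IHx IHx'|a k]; first by rewrite !(mul0r, malg_star0, mulr0).
  by rewrite mulrDl !malg_starD mulrDr IHx IHx'.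
elim/malg_ind: y => [|y y' IHy IHy'|b l]; first by rewrite !(mulr0, malg_star0, mul0r).
  by rewrite mulrDr !malg_starD mulrDl IHy IHy'.
by rewrite malgUM !malg_starU malgUM sM rmorphM mulrC.
Qed.

Lemma tensEw (K K' : monomType) (d : {fset K}) (d' : {fset K'})
    (x : {malg C[K]}) (y : {malg C[K']}) :
  (msupp x `<=` d)%fset -> (msupp y `<=` d')%fset ->
  tens x y = \sum_(u <- d) \sum_(v <- d') << x@_u * y@_v *g (u, v) >>.
Proof.
move=> sx sy; rewrite /tens (big_fset_incl _ sx) /=; last first.
  by move=> u _ /mcoeff_outdom ->; apply: big1 => v _; rewrite mul0r monalgU0.
apply: eq_bigr => u _; apply: (big_fset_incl _ sy) => v _ /mcoeff_outdom ->.
by rewrite mulr0 monalgU0.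
Qed.

Lemma tensDl (K K' : monomType) (x x' : {malg C[K]}) (y : {malg C[K']}) :
  tens (x + x') y = tens x y + tens x' y.
Proof.
pose d := (msupp x `|` msupp x')%fset; have sy := fsubset_refl (msupp y).
rewrite (@tensEw _ _ d _ (x + x') y _ sy); last exact: msuppD_le.
rewrite (@tensEw _ _ d _ x y _ sy) ?fsubsetUl //.
rewrite (@tensEw _ _ d _ x' y _ sy) ?fsubsetUr // -big_split.
apply: eq_bigr => u _; rewrite -big_split; apply: eq_bigr => v _.
by rewrite mcoeffD mulrDl monalgUD.
Qed.

Lemma tensDr (K K' : monomType) (x : {malg C[K]}) (y y' : {malg C[K']}) :
  tens x (y + y') = tens x y + tens x y'.
Proof.
pose d := (msupp y `|` msupp y')%fset; have sx := fsubset_refl (msupp x).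
rewrite (@tensEw _ _ _ d x (y + y') sx); last exact: msuppD_le.
rewrite (@tensEw _ _ _ d x y sx) ?fsubsetUl //.
rewrite (@tensEw _ _ _ d x y' sx) ?fsubsetUr // -big_split.
apply: eq_bigr => u _; rewrite -big_split; apply: eq_bigr => v _.
by rewrite mcoeffD mulrDr monalgUD.
Qed.

Lemma tens0l (K K' : monomType) (y : {malg C[K']}) :
  tens (0 : {malg C[K]}) y = 0.
Proof. by rewrite /tens msupp0 big_seq_fset0. Qed.

Lemma tens0r (K K' : monomType) (x : {malg C[K]}) :
  tens x (0 : {malg C[K']}) = 0.
Proof. by apply: big1 => u _; rewrite msupp0 big_seq_fset0. Qed.

Lemma tensUU (K K' : monomType) (a b : C) (k : K) (l : K') :
  tens << a *g k >> << b *g l >> = << a * b *g (k, l) >>.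
Proof.
rewrite (@tensEw _ _ [fset k]%fset [fset l]%fset _ _ msuppU_le msuppU_le).
by rewrite !big_seq_fset1 !mcoeffUU.
Qed.

Lemma tensM (K K' : monomType) (x x' : {malg C[K]}) (y y' : {malg C[K']}) :
  tens x y * tens x' y' = tens (x * x') (y * y').
Proof.
elim/malg_ind: x => [|x1 x2 IH1 IH2|a k]; first by rewrite !(tens0l, mul0r).
  by rewrite !(tensDl, mulrDl) IH1 IH2.
elim/malg_ind: y => [|y1 y2 IH1 IH2|b l]; first by rewrite !(tens0r, mul0r).
  by rewrite !(tensDr, mulrDl) IH1 IH2.
elim/malg_ind: x' => [|x1 x2 IH1 IH2|a' k']; first by rewrite !(tens0l, mulr0).
  by rewrite !(tensDl, mulrDr) IH1 IH2.
elim/malg_ind: y' => [|y1 y2 IH1 IH2|b' l']; first by rewrite !(tens0r, mulr0).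
  by rewrite !(tensDr, mulrDr) IH1 IH2.
by rewrite !tensUU !malgUM tensUU mulrACA.
Qed.

Lemma tens_starE (K K' : monomType) (s : K -> K) (s' : K' -> K')
    (x : {malg C[K]}) (y : {malg C[K']}) :
  malg_star (fun p : K * K' => (s p.1, s' p.2)) (tens x y)
    = tens (malg_star s x) (malg_star s' y).
Proof.
elim/malg_ind: x => [|x1 x2 IH1 IH2|a k]; first by rewrite !(tens0l, malg_star0).
  by rewrite tensDl !malg_starD tensDl IH1 IH2.
elim/malg_ind: y => [|y1 y2 IH1 IH2|b l]; first by rewrite !(tens0r, malg_star0).
  by rewrite tensDr !malg_starD tensDr IH1 IH2.
by rewrite tensUU !malg_starU tensUU rmorphM.
Qed.

Lemma malg_ext_star (K K' : monomType) (s : K -> K) (s' : K' -> K')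
    (h : K -> {malg C[K']}) :
  (forall k, h (s k) = malg_star s' (h k)) ->
  forall x, malg_ext h (malg_star s x) = malg_star s' (malg_ext h x).
Proof.
move=> hs; elim/malg_ind => [|x y IHx IHy|c k]; first by rewrite malg_star0 malg_ext0 malg_star0.
  by rewrite malg_starD !malg_extD malg_starD IHx IHy.
rewrite malg_starU !malg_extU hs.
elim/malg_ind: (h k) => [|x y IHx IHy|d l]; first by rewrite !(malg_star0, scaler0).
  by rewrite !(malg_starD, scalerDr) IHx IHy.
by rewrite -!mul_malgC malgUM mul1m !malg_starU malgUM mul1m rmorphM.
Qed.

End MonoidAlgebraTheory.

Lemma word_starM (X : choiceType) (s : X -> X) (u v : {fmonom X}) :
  word_star s (mmul u v) = mmul (word_star s v) (word_star s u).
Proof. by rewrite /word_star fmM map_cat rev_cat [RHS]fmmulE. Qed.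

Lemma word_star1 (X : choiceType) (s : X -> X) :
  word_star s mone = mone.
Proof. by rewrite /word_star fm1 [RHS]fmoneE. Qed.

(* [j m] is the unital *-homomorphism with the prescribed values on letters. *)
Section JMorphism.

Variables (C : numClosedFieldType) (G : bool -> choiceType) (m : nat).
Notation j := (@j C G m).

Lemma j1E : j 1 = 1.
Proof.
by rewrite /j malg_extU scale1r fm1 big_nil.
Qed.

Lemma jM : {morph j : x y / x * y}.
Proof. by apply: malg_extM => u v; rewrite fmM big_cat. Qed.

Lemma jZ c x : j (c *: x) = c *: j x.
Proof. exact: malg_extZ. Qed.

Lemma jD x y : j (x + y) = j x + j y.
Proof. exact: malg_extD. Qed.

Lemma j_incl1 (a : letter G false) : j (incl << fmu a >>) = j1 C m a.
Proof.
by rewrite /j /incl !malg_extU !scale1r malg_extU scale1r fmU big_seq1.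
Qed.

Lemma j_incl2 (b : letter G true) : j (incl << fmu b >>) = j2 C m b.
Proof.
by rewrite /j /incl !malg_extU !scale1r malg_extU scale1r fmU big_seq1.
Qed.

Let tpow_star l : tpow_monom G m l -> tpow_monom G m l :=
  fun u => [ffun i => word_star (@tletter_star G l) (u i)].

Let tens_incl_star l k (a : letter G l) :
  malg_star (@tpow_star l) (tens_incl m k (talg_letter C a))
    = tens_incl m k (talg_letter C (letter_star a)).
Proof.
rewrite /tens_incl; case: (k <= m)%N; last by rewrite malg_star0.
rewrite /talg_letter !malg_extU. rewrite !scale1r. rewrite malg_starU. rewrite rmorph1.
congr (<< _ *g _ >>). apply/ffunP=> i. rewrite !ffunE.
case: ifP => _. by rewrite /word_star fmU [RHS]fmuE. by rewrite word_star1.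
Qed.

Let tens_t_star l k :
  malg_star (@tpow_star l) (tens_t C G l m k) = tens_t C G l m k.
Proof.
rewrite /tens_t malg_starU rmorph1; congr (<< _ *g _ >>).
apply/ffunP=> i; rewrite !ffunE.
by case: ifP => _; rewrite ?word_star1 // /word_star fmU [RHS]fmuE.
Qed.

Let tens_star_tens x y :
  tens_star (tens x y : tens_alg C G m)
    = tens (malg_star (@tpow_star false) x) (malg_star (@tpow_star true) y).
Proof. exact: tens_starE. Qed.

Lemma j_letter_star (x : fletter G) :
  j_letter C m (fletter_star x) = tens_star (j_letter C m x).
Proof.
case: x => -[] a; rewrite /= /j1 /j2 [RHS]malg_star_sum; apply: eq_bigr => k _;
  by rewrite [RHS]tens_star_tens malg_starB !tens_incl_star tens_t_star.
Qed.

Lemma j_star (x : falg C G) : j (falg_star x) = tens_star (j x).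
Proof.
apply: malg_ext_star => w; rewrite /word_star /=.
elim: (w : seq _) => [|a s IHs] /=.
  rewrite !big_nil malg_starU rmorph1; congr (<< _ *g _ >>).
  by congr pair; apply/ffunP => i; rewrite !ffunE word_star1.
rewrite rev_cons -cats1 big_cat /= big_seq1 big_cons IHs j_letter_star.
rewrite malg_starM // => u v; congr pair; apply/ffunP=> i;
  by rewrite !ffunE word_starM.
Qed.

End JMorphism.

(* Main.v *)
Require Import Defs.
From HB Require Import structures.
From mathcomp Require Import all_boot all_order all_algebra.
From mathcomp Require Import finmap complex reals monalg.
From mathcomp Require Import ring.

Set Implicit Arguments.
Unset Strict Implicit.
Unset Printing Implicit Defensive.

Import Order.TTheory GRing.Theory Num.Theory.

Local Open Scope ring_scope.

(** For a functional phi on A_l, think of its Boolean extension as a vacuum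
    expectation in a representation where t is the projection onto the vacuum:
    this is what the product formula over the blocks between the letters t says
    ([bool_ext_word_t]).  The tensor product then has m sites on each of two
    sides, and t_[k,m] on one side projects onto the vectors that are in the
    vacuum at every site from the k-th on.  In the lemmas the sites are counted
    from 0, so that site 0 carries phi and the others psi.

    Call k the depth of a vector on a side when the tail projections of that
    side starting before site k kill it and the others fix it.  The sum
    defining j on a letter telescopes on a vector which has depth k on the
    opposite side: only the letter at site k survives.  This property passes to
    products and linear combinations, so every x in A_l, the unit included,
    acts on such a vector as x placed at site k ([J_acts]).  If moreover that
    site is still in its vacuum, then subtracting the mean of x in the state of
    site k leaves a vector of depth k + 1 on the side of x ([depth_step]).  The
    subtracted mean is phi(x) on the vacuum vector, and psi(x) afterwards.

    Hence, when the factors of an alternating product of centred elements are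
    applied one by one to the vacuum, each contributes phi(x) as long as the
    vector stays in the vacuum; once it has left the vacuum, the vector climbs
    by one site per factor, alternating between the two sides ([depth_push]).
    Each side has m sites only, so a ket can be pushed through at most m
    factors; but the same happens to bras from the left.  A product of
    n <= 2m factors is therefore cut into two halves of at most m factors.  A
    bra and a ket obtained from the two halves are deepest on opposite sides
    and hence orthogonal, unless both are the vacuum ([depth_orthogonal]), so
    that only the product of the phi(x) remains ([Phi_factor_prod_centred]):
    the value of the conditionally free product.

    Finally, two linear functionals which agree on alternating products of at
    most n centred elements agree on all products of at most n elements, by
    subtracting means and merging neighbours ([eq_on_products]); empty words
    among the w_i are covered as well. *)

(** * The depth calculus *)

Notation alternating_sides s :=
  (sorted (fun a b : bool => a != b) (map tag s)).

Lemma rev_sorted_neq (s : seq bool) :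
  sorted (fun a b => a != b) (rev s) = sorted (fun a b => a != b) s.
Proof. by rewrite rev_sorted; apply: eq_sorted => a b; rewrite eq_sym. Qed.

(** [E k x] stands for x at site k, [P l k] for t at all the sites from k on of
    side l, and [J] for the restriction of j to the two algebras.  The section
    isolates the relations between them from which the value of the state on
    centred products follows. *)
Section DepthCalculus.

Variables (C : comNzRingType) (T : lalgType C) (A : bool -> lalgType C).
Variables (L : bool -> Type) (gen : forall l, L l -> A l).
Variables (m : nat) (Phi : T -> C) (P : bool -> nat -> T).
Variables (E : forall l, nat -> A l -> T) (J : forall l, A l -> T).
Variables (phi psi : forall l, A l -> C).

Hypothesis mulrZ : forall c (x y : T), x * (c *: y) = c *: (x * y).
Hypothesis A_ind : forall l (Q : A l -> Prop), Q 1 -> (forall a, Q (gen a)) ->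
  (forall x y, Q x -> Q y -> Q (x * y)) ->
  (forall x y, Q x -> Q y -> Q (x + y)) ->
  (forall c x, Q x -> Q (c *: x)) -> forall x, Q x.

Hypothesis PhiD : forall x y, Phi (x + y) = Phi x + Phi y.
Hypothesis PhiZ : forall c x, Phi (c *: x) = c * Phi x.
Hypothesis Phi1 : Phi 1 = 1.
Hypothesis PhiPl : forall l k v, Phi (P l k * v) = Phi v.
Hypothesis PhiPr : forall l k v, Phi (v * P l k) = Phi v.

Hypothesis J1 : forall l, J (1 : A l) = 1.
Hypothesis JM : forall l (x y : A l), J (x * y) = J x * J y.
Hypothesis JD : forall l (x y : A l), J (x + y) = J x + J y.
Hypothesis JZ : forall l c (x : A l), J (c *: x) = c *: J x.
Hypothesis E1 : forall l k, (k < m)%N -> E k (1 : A l) = 1.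
Hypothesis EM : forall l k (x y : A l), (k < m)%N ->
  E k (x * y) = E k x * E k y.
Hypothesis ED : forall l k (x y : A l), E k (x + y) = E k x + E k y.
Hypothesis EZ : forall l k c (x : A l), E k (c *: x) = c *: E k x.
(* The convention i_{m+1,m} = 0, which makes the telescoping sum end. *)
Hypothesis E_out : forall l (x : A l), E m x = 0.

Hypothesis J_gen : forall l (a : L l),
  J (gen a) = \sum_(0 <= k < m) (E k (gen a) - E k.+1 (gen a)) * P (~~ l) k.
Hypothesis EP_comm : forall l l' k k' (x : A l), (l' != l) || (k < k')%N ->
  E k x * P l' k' = P l' k' * E k x.

Let site_state l k (x : A l) := if k == 0%N then phi x else psi x.

(* At site k this is t x t = s(x) t, s being the state of that site, and at the
   sites above k it is t t = t; these hold in T only modulo Phi. *)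
Hypothesis compress : forall l k i j (x : A l) z v,
  (k < m)%N -> (i <= k)%N -> (j <= k)%N ->
  Phi (z * (P l i * E k x * P l j) * v)
    = site_state k x * Phi (z * P l (minn i j) * v).

Lemma PhiB x y : Phi (x - y) = Phi x - Phi y.
Proof. by rewrite PhiD -scaleN1r PhiZ mulN1r. Qed.

Lemma Phi0 : Phi 0 = 0.
Proof. by rewrite -(subrr 0) PhiB subrr. Qed.

Definition factor := {l : bool & A l}.

Definition centred (x : factor) := psi (tagged x) == 0.

Definition alternates (l : bool) (s : seq factor) :=
  path (fun a b => a != b) l (map tag s).

(** Kets (d = false, T acting on the left) and bras (d = true, T acting on the
    right) are treated together. *)
Section OneSide.

Variable d : bool.

Definition dmul (a v : T) : T := if d then v * a else a * v.

Local Notation "a · v" := (dmul a v) (at level 40, left associativity).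

Lemma dmulA a b v : a · (b · v) = a · b · v.
Proof. by rewrite /dmul; case: d; rewrite mulrA. Qed.

Lemma dmulDr a v w : a · (v + w) = a · v + a · w.
Proof. by rewrite /dmul; case: d; rewrite ?mulrDl ?mulrDr. Qed.

Lemma dmulDl a b v : (a + b) · v = a · v + b · v.
Proof. by rewrite /dmul; case: d; rewrite ?mulrDl ?mulrDr. Qed.

Lemma dmulZr a c v : a · (c *: v) = c *: (a · v).
Proof. by rewrite /dmul; case: d; rewrite ?mulrZ -?scalerAl. Qed.

Lemma dmulZl a c v : (c *: a) · v = c *: (a · v).
Proof. by rewrite /dmul; case: d; rewrite ?mulrZ -?scalerAl. Qed.

Lemma dmulBr a v w : a · (v - w) = a · v - a · w.
Proof. by rewrite -!scaleN1r dmulDr dmulZr. Qed.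

Lemma dmul0 a : a · 0 = 0.
Proof. by rewrite /dmul; case: d; rewrite ?mul0r ?mulr0. Qed.

Lemma dmul1r v : v · 1 = v.
Proof. by rewrite /dmul; case: d; rewrite ?mul1r ?mulr1. Qed.

Lemma dmul_suml I (r : seq I) (F : I -> T) v :
  (\sum_(i <- r) F i) · v = \sum_(i <- r) F i · v.
Proof. by rewrite /dmul; case: d; rewrite ?mulr_suml ?mulr_sumr. Qed.

Lemma dmulM a b v : (a * b) · v = if d then b · (a · v) else a · (b · v).
Proof. by rewrite /dmul; case: d; rewrite mulrA. Qed.

Lemma dmul_comm a b v : a * b = b * a -> a · (b · v) = (a * b) · v.
Proof. by rewrite /dmul => ab; case: d; [rewrite ab mulrA | rewrite mulrA]. Qed.

(** Equality of the vectors v and w in the quotient of T by the null vectors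
    of Phi. *)
Definition eqv v w := forall z, Phi (z · v) = Phi (z · w).

Local Notation "v ≈ w" := (eqv v w) (at level 70).

Lemma eqv_refl v : v ≈ v. Proof. by []. Qed.

Lemma eqv_sym v w : v ≈ w -> w ≈ v.
Proof. by move=> vw z; rewrite vw. Qed.

Lemma eqv_trans w v u : v ≈ w -> w ≈ u -> v ≈ u.
Proof. by move=> vw wu z; rewrite vw. Qed.

Lemma eqv_mul a v w : v ≈ w -> a · v ≈ a · w.
Proof. by move=> vw z; rewrite !dmulA vw. Qed.

Lemma eqvD v w v' w' : v ≈ w -> v' ≈ w' -> v + v' ≈ w + w'.
Proof. by move=> vw vw' z; rewrite !dmulDr !PhiD vw vw'. Qed.

Lemma eqvZ c v w : v ≈ w -> c *: v ≈ c *: w.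
Proof. by move=> vw z; rewrite !dmulZr !PhiZ vw. Qed.

Lemma eqvB v w v' w' : v ≈ w -> v' ≈ w' -> v - v' ≈ w - w'.
Proof.
by move=> vw vw'; rewrite -!scaleN1r; apply: eqvD => //; apply: eqvZ.
Qed.

Lemma eqv_sum n (F H : nat -> T) : (forall k, (k < n)%N -> F k ≈ H k) ->
  \sum_(0 <= k < n) F k ≈ \sum_(0 <= k < n) H k.
Proof.
elim: n => [|n IHn] FH; first by rewrite !big_nil.
rewrite !big_nat_recr //=; apply: eqvD; last exact: FH.
by apply: IHn => k /ltnW; apply: FH.
Qed.

(** Beyond its first k sites, side l is in the vacuum; and no shorter segment will
    do, in the strong sense that every tail starting inside it kills v. *)
Definition exact_depth l k v := forall k', (k' < m)%N ->
  P l k' · v ≈ if (k' < k)%N then 0 else v.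

(** Side l is in the vacuum from site k - 1 on: in the climb, the side which did
    not move last is at least one site behind. For k = 0 this says the same as
    for k = 1. *)
Definition depth_below l k v := forall k', (k' < m)%N -> (k <= k'.+1)%N ->
  P l k' · v ≈ v.

Definition depth l k v := exact_depth l k v /\ depth_below (~~ l) k v.

Lemma exact_depth_E l k i (x : A l) v :
  exact_depth (~~ l) k v -> exact_depth (~~ l) k (E i x · v).
Proof.
move=> dv k' lt_k'm.
have PE : P (~~ l) k' * E i x = E i x * P (~~ l) k'.
  by rewrite EP_comm //; case: (l).
rewrite (dmul_comm _ PE) PE -(dmul_comm _ (esym PE)).
have -> : (if (k' < k)%N then 0 else E i x · v)
    = E i x · (if (k' < k)%N then 0 else v) by case: ifP; rewrite ?dmul0.
exact/eqv_mul/dv.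
Qed.

(** On a vector of exact depth k on the opposite side, the terms of J below k
    vanish and the others telescope from E k to E m = 0.  As E k x commutes
    with the opposite projections it preserves this depth, so the property is
    inherited by products. *)
Lemma J_acts l k (x : A l) v : (k < m)%N -> exact_depth (~~ l) k v ->
  J x · v ≈ E k x · v.
Proof.
move=> lt_km; elim/A_ind: x v => [|a|x y IHx IHy|x y IHx IHy|c x IHx] v dv.
- by rewrite J1 E1.
- rewrite J_gen dmul_suml.
  apply: (@eqv_trans (\sum_(0 <= i < m)
      (E i (gen a) - E i.+1 (gen a)) · (if (i < k)%N then 0 else v))).
    apply: eqv_sum => i lt_im; rewrite -dmul_comm; first exact/eqv_mul/dv.
    by rewrite mulrBl mulrBr !EP_comm //; case: (l).
  rewrite (big_cat_nat (leq0n k) (ltnW lt_km)) big_nat big1 ?add0r; last first.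
    by move=> i /andP[_ ->]; rewrite dmul0.
  rewrite (eq_big_nat _ _ (F2 := fun i => (E i (gen a) - E i.+1 (gen a)) · v)).
    rewrite -dmul_suml.
    have -> : \sum_(k <= i < m) (E i (gen a) - E i.+1 (gen a)) = E k (gen a).
      have := telescope_sumr (fun i => - E i (gen a)) (ltnW lt_km).
      rewrite E_out oppr0 add0r opprK => <-.
      by apply: eq_bigr => i _; rewrite opprK addrC.
    rewrite /= add0r; exact: eqv_refl.
  by move=> i /andP[le_ki _]; rewrite ltnNge le_ki.
- rewrite JM EM //.
  rewrite !dmulM; case: ifP => _.
    by apply: eqv_trans (IHy _ _); [apply/eqv_mul/IHx | apply: exact_depth_E].
  by apply: eqv_trans (IHx _ _); [apply/eqv_mul/IHy | apply: exact_depth_E].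
- rewrite JD ED !dmulDl; apply: eqvD; [exact: IHx | exact: IHy].
- rewrite JZ EZ !dmulZl; apply: eqvZ; exact: IHx.
Qed.

Lemma eqv_compress l k i j (x : A l) v :
  (k < m)%N -> (i <= k)%N -> (j <= k)%N ->
  P l i · (E k x · (P l j · v)) ≈ site_state k x *: (P l (minn i j) · v).
Proof.
move=> lt_km le_ik le_jk z; rewrite dmulZr PhiZ /dmul; case: d.
  by rewrite minnC -compress // !mulrA.
by have := compress x z v lt_km le_ik le_jk; rewrite !mulrA.
Qed.

Lemma depth_vacuum l : depth l 0 1.
Proof.
have PV l' k' : P l' k' · 1 ≈ 1.
  by move=> z; rewrite !dmul1r /dmul; case: d; rewrite ?PhiPl ?PhiPr.
by split=> k' _ => [|_]; rewrite ?ltn0; apply: PV.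
Qed.

(** The climb by one site.  Site k of side l is in the vacuum for v, so after
    projecting back onto the vacuum x contributes its mean at that site, which
    is subtracted. *)
Lemma depth_step l k (x : A l) v : (k < m)%N -> depth (~~ l) k v ->
  depth l k.+1 (J x · v - site_state k x *: v).
Proof.
move=> lt_km [dv]; rewrite negbK => bv.
have Jv := J_acts x lt_km dv.
have PJ l' k' : P l' k' · (J x · v - site_state k x *: v)
    ≈ P l' k' · (E k x · v) - site_state k x *: (P l' k' · v).
  by rewrite dmulBr dmulZr; apply: eqvB; [apply: eqv_mul | apply: eqv_refl].
have Jv' : J x · v - site_state k x *: v ≈ E k x · v - site_state k x *: v.
  by apply: eqvB; [exact: Jv | apply: eqv_refl].
split=> k' lt_k'm; last first.
  rewrite ltnS => le_kk'.
  apply: eqv_trans (PJ _ _) _; apply: eqv_trans (eqv_sym Jv').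
  apply: eqvB.
    by have := exact_depth_E k x dv lt_k'm; rewrite ltnNge le_kk'.
  by apply: eqvZ; have := dv _ lt_k'm; rewrite ltnNge le_kk'.
apply: eqv_trans (PJ _ _) _; rewrite ltnS; case: leqP => [le_k'k|lt_kk'].
  apply: (@eqv_trans (site_state k x *: (P l k' · v)
      - site_state k x *: (P l k' · v))).
    apply: eqvB; last exact: eqv_refl.
    apply: (@eqv_trans (P l k' · (E k x · (P l k · v)))).
      by do 2!apply: eqv_mul; apply: eqv_sym; apply: bv.
    have := @eqv_compress _ _ k' k x v lt_km le_k'k (leqnn k).
    by rewrite (minn_idPl le_k'k).
  by rewrite subrr; apply: eqv_refl.
apply: eqv_trans (eqv_sym Jv'); apply: eqvB; last first.
  by apply/eqvZ/bv => //; apply: leqW; apply: ltnW.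
have PE : P l k' * E k x = E k x * P l k' by rewrite EP_comm // lt_kk' orbT.
rewrite (dmul_comm _ PE) PE -(dmul_comm _ (esym PE)).
by apply/eqv_mul/bv => //; apply: leqW; apply: ltnW.
Qed.

(** Once the vacuum has been left (0 < k), the means to subtract are those of
    psi; they vanish for centred factors, which thus climb freely. *)
Lemma depth_push l k (s : seq factor) v :
  alternates l s -> all centred s ->
  (0 < k)%N -> (k + size s <= m)%N -> depth l k v ->
  depth (last l (map tag s)) (k + size s)
    (foldl (fun u x => J (tagged x) · u) v s).
Proof.
elim: s l k v => [|x s IHs] l k v /=; first by rewrite addn0.
case/andP=> lx alt_s /andP[/eqP cx cs] k_gt0 le_km dv.
rewrite addnS -addSn in le_km *.
apply: IHs => //.
have l_x : l = ~~ tag x by case: (tag x) l lx {dv alt_s} => -[].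
have := @depth_step (tag x) k (tagged x) v; rewrite -l_x.
have -> : site_state k (tagged x) = 0.
  by rewrite /site_state eqn0Ngt k_gt0.
rewrite scale0r subr0; apply=> //.
by apply: leq_trans le_km; rewrite leq_addr.
Qed.

End OneSide.

Definition factor_prod (s : seq factor) : T := \prod_(x <- s) J (tagged x).

Lemma foldl_dmul_bra (s : seq factor) v :
  foldl (fun u x => dmul true (J (tagged x)) u) v s = v * factor_prod s.
Proof.
elim: s v => [|x s IHs] v; first by rewrite /factor_prod big_nil mulr1.
by rewrite /= IHs /factor_prod big_cons mulrA.
Qed.

Lemma foldl_dmul_ket (s : seq factor) v :
  foldl (fun u x => dmul false (J (tagged x)) u) v (rev s) = factor_prod s * v.
Proof.
elim: s v => [|x s IHs] v; first by rewrite /factor_prod big_nil mul1r.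
by rewrite rev_cons -cats1 foldl_cat /= IHs /factor_prod big_cons mulrA.
Qed.

(** On the side of the deeper vector, of depth k' say, the tail from site k' - 1
    kills that vector and fixes the other one, whose vacuum on this side begins
    no later. *)
Lemma depth_orthogonal l k k' v u :
  (k <= m)%N -> (k' <= m)%N -> (0 < k + k')%N ->
  depth false l k v -> depth true (~~ l) k' u -> Phi (u * v) = 0.
Proof.
move=> le_km le_k'm kk' [dv bv] [du bu]; rewrite negbK in bu.
have [le_kk'|/ltnW le_k'k] := leqP k k'.
  have k'_gt0 : (0 < k')%N.
    by move: le_kk' kk'; case: (k') => //; rewrite leqn0 => /eqP->.
  have lt_m : (k'.-1 < m)%N by rewrite prednK.
  have := bv k'.-1 lt_m; rewrite prednK // => /(_ le_kk' u) <-.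
  have := du k'.-1 lt_m v; rewrite prednK // leqnn /dmul mul0r mulrA => ->.
  exact: Phi0.
have k_gt0 : (0 < k)%N.
  by move: le_k'k kk'; case: (k) => //; rewrite leqn0 addnC addn0 => /eqP->.
have lt_m : (k.-1 < m)%N by rewrite prednK.
have := bu k.-1 lt_m; rewrite prednK // => /(_ le_k'k v); rewrite /dmul => <-.
have := dv k.-1 lt_m u; rewrite prednK // leqnn /dmul mulr0 mulrA => ->.
exact: Phi0.
Qed.

Lemma depth_start d (x : factor) : (0 < m)%N ->
  depth d (tag x) 1 (J (tagged x) - phi (tagged x) *: 1).
Proof.
move=> m_gt0; have := depth_step (tagged x) m_gt0 (depth_vacuum d (~~ tag x)).
by rewrite dmul1r.
Qed.

(** Peeling off the leftmost factor x splits the bra into phi(x) times the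
    vacuum, dealt with by induction, and a bra of depth 1, which the remaining
    factors push up until it meets the ket v. *)
Lemma Phi_factor_prod_depth s l k v : alternates l (rev s) -> all centred s ->
  (size s <= m)%N -> (0 < k <= m)%N -> depth false l k v ->
  Phi (factor_prod s * v) = 0.
Proof.
move=> alt_s cs le_sm /andP[k_gt0 le_km] dv.
elim: s alt_s cs le_sm => [|x s IHs].
  move=> _ _ _; rewrite /factor_prod big_nil.
  apply: (depth_orthogonal le_km (leq0n m) _ dv); first by rewrite addn0.
  exact: depth_vacuum.
move=> alt_xs /= /andP[_ cs] lt_sm.
have m_gt0 : (0 < m)%N by apply: leq_ltn_trans lt_sm.
have alt_s : alternates l (rev s).
  by move: alt_xs; rewrite /alternates rev_cons map_rcons rcons_path => /andP[].
have [alt_xs' last_x] : alternates (tag x) s /\ last (tag x) (map tag s) = ~~ l.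
  move: alt_xs; rewrite /alternates map_rev.
  rewrite -[path _ _ _]/(sorted _ (l :: rev _)).
  rewrite -rev_rcons rev_sorted_neq /= rcons_path => /andP[-> last_l].
  by split=> //; case: (last _ _) (l) last_l => -[].
have := depth_orthogonal le_km _ _ dv.
have := @depth_push true (tag x) 1 s _ alt_xs' cs isT lt_sm
  (depth_start true x m_gt0).
rewrite foldl_dmul_bra last_x => du /(_ _ _ lt_sm _ du).
rewrite addnS => /(_ isT); rewrite !mulrBl -!scalerAl mul1r PhiB PhiZ.
rewrite IHs ?(ltnW lt_sm) // mulr0 subr0 => <-.
by rewrite /factor_prod big_cons.
Qed.

(** Peeling off the rightmost factor x leaves phi(x) times the product of the
    others, plus a ket of depth 1.  The right half of the other factors pushes
    this ket up and the left half annihilates the result; 2 m is the largest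
    length for which both halves have room. *)
Lemma Phi_factor_prod_centred s : alternating_sides s ->
  all centred s -> (size s <= 2 * m)%N ->
  Phi (factor_prod s) = \prod_(x <- s) phi (tagged x).
Proof.
elim/last_ind: s => [|s x IHs] alt_s.
  by rewrite /factor_prod !big_nil Phi1.
rewrite all_rcons size_rcons => /andP[_ cs] lt_s2m.
have m_gt0 : (0 < m)%N by case: (m) lt_s2m.
have := depth_start false x m_gt0; set v := J _ - _ => dv.
have alt_rs : alternates (tag x) (rev s).
  rewrite /alternates -[path _ _ _]/(sorted _ (_ :: _)) map_rev -rev_rcons.
  by rewrite -map_rcons rev_sorted_neq.
have Phi_v : Phi (factor_prod s * v) = 0.
  have eq_s := cat_take_drop m s; move: alt_rs cs; rewrite -eq_s all_cat.
  rewrite rev_cat /alternates map_cat cat_path => /andP[alt2 alt1] /andP[c1 c2].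
  have le_d : (1 + size (drop m s) <= m)%N.
    rewrite size_drop add1n; move: lt_s2m; rewrite mul2n -addnn => lt_s2m.
    have [/eqP-> //|le] := leqP (size s) m.
    by rewrite -subSn ?leq_subLR // ltnW.
  rewrite {1}/factor_prod big_cat -mulrA.
  have := @depth_push false (tag x) 1 (rev (drop m s)) v alt2.
  rewrite all_rev size_rev foldl_dmul_ket => /(_ c2 isT le_d dv).
  apply: Phi_factor_prod_depth => //.
  by rewrite size_take; case: ifP => // /negbT; rewrite -leqNgt.
have -> : factor_prod (rcons s x)
    = phi (tagged x) *: factor_prod s + factor_prod s * v.
  by rewrite /factor_prod -cats1 big_cat big_seq1 mulrBr mulrZ mulr1 addrC subrK.
rewrite PhiD Phi_v addr0 PhiZ IHs ?(ltnW lt_s2m) //.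
  by rewrite -cats1 big_cat big_seq1 mulrC.
move: alt_s; rewrite map_rcons; case: (map _ _) => //= b t.
by rewrite rcons_path => /andP[].
Qed.

End DepthCalculus.

(** * Reduction to centred elements *)

Section CentringReduction.

Variables (C : comNzRingType) (B : lalgType C) (A : bool -> lalgType C).
Variables (iota : forall l, A l -> B) (psi : forall l, A l -> C).

Hypothesis mulrZ : forall c (x y : B), x * (c *: y) = c *: (x * y).
Hypothesis iotaM : forall l (x y : A l), iota (x * y) = iota x * iota y.
Hypothesis iotaD : forall l (x y : A l), iota (x + y) = iota x + iota y.
Hypothesis iotaZ1 : forall l c, iota (c *: 1 : A l) = c *: 1.
Hypothesis psi1 : forall l c (x : A l), psi (x - c *: 1) = psi x - c.

Variables (f g : B -> C) (n : nat).
Hypothesis fD : forall x y, f (x + y) = f x + f y.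
Hypothesis fZ : forall c x, f (c *: x) = c * f x.
Hypothesis gD : forall x y, g (x + y) = g x + g y.
Hypothesis gZ : forall c x, g (c *: x) = c * g x.

Local Notation iprod := (@factor_prod C B A iota).

Hypothesis fg_centred : forall s : seq (factor A),
  alternating_sides s -> all (centred psi) s ->
  (size s <= n)%N -> f (iprod s) = g (iprod s).

(** A product is processed from left to right, behind a prefix p of centred
    alternating factors kept in reverse order.  A factor on the side of the
    last prefix factor is merged with it and goes back to the unprocessed part;
    otherwise it is centred, and the product with the mean in its place is
    shorter.  Each move decreases size p + 2 * size t, and none increases
    size p + size t. *)
Lemma eq_on_products (s : seq (factor A)) : (size s <= n)%N ->
  f (iprod s) = g (iprod s).
Proof.
have iprod_cons x t : iprod (x :: t) = iota (tagged x) * iprod t.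
  exact: big_cons.
have iprod_rev x t : iprod (rev (x :: t)) = iprod (rev t) * iota (tagged x).
  by rewrite /factor_prod rev_cons -cats1 big_cat big_seq1.
have base p : (size p + 0 <= n)%N -> alternating_sides p ->
    all (centred psi) p -> f (iprod (rev p)) = g (iprod (rev p)).
  rewrite addn0 => le_n alt_p cp.
  apply: fg_centred; rewrite ?all_rev ?size_rev //.
  by rewrite map_rev rev_sorted_neq.
suff IH k (p t : seq (factor A)) : (size p + 2 * size t <= k)%N ->
    (size p + size t <= n)%N -> alternating_sides p ->
    all (centred psi) p ->
    f (iprod (rev p) * iprod t) = g (iprod (rev p) * iprod t).
  move=> le_sn; have := IH _ [::] s (leqnn _) le_sn isT isT.
  by rewrite /rev /= {1 3}/factor_prod big_nil mul1r.
elim: k p t => [|k IHk] p [|x t] /= le_k le_n alt_p cp.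
- rewrite {2 4}/factor_prod big_nil mulr1; exact: base.
- by move: le_k; rewrite mulnS addnCA.
- rewrite {2 4}/factor_prod big_nil mulr1; exact: base.
rewrite mulnS addnCA !add2n ltnS in le_k; rewrite addnS in le_n.
have [same|alt_xp] : (exists y q, p = y :: q /\ tag y = tag x) \/
    sorted (fun a b => a != b) (tag x :: map tag p).
  case: p alt_p {le_k le_n cp} => [|y q] /=; first by right.
  have [xy|xy] := eqVneq (tag y) (tag x) => alt; first by left; exists y, q.
  by right.
  case: same => -[l y] [q [def_p]]; case: x le_k le_n => l' x /= le_k le_n ll'.
  case: l' / ll' x le_k le_n => x le_k le_n.
  move: alt_p cp le_k le_n; rewrite def_p /=.
  move=> alt_q /andP[_ cq] le_k le_n.
  have -> : iprod (rev (existT _ l y :: q)) * iprod (existT _ l x :: t)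
      = iprod (rev q) * iprod (existT (fun l => A l) l (y * x) :: t).
    by rewrite iprod_rev !iprod_cons /= iotaM !mulrA.
  rewrite addSn in le_k; apply: IHk => //=; last exact: path_sorted alt_q.
    by rewrite mulnS addnCA.
  by rewrite addnS -addSn ltnW.
set c := psi (tagged x).
have -> : iprod (rev p) * iprod (x :: t)
    = iprod (rev (existT (fun l => A l) _ (tagged x - c *: 1) :: p))
        * iprod t
      + c *: (iprod (rev p) * iprod t).
  have -> : iprod (x :: t) = iota (tagged x - c *: 1 + c *: 1) * iprod t.
    by rewrite subrK iprod_cons.
  rewrite iprod_rev /= [in LHS]iotaD iotaZ1.
  by rewrite mulrDl mulrDr mulrA -scalerAl mul1r mulrZ.
rewrite fD gD fZ gZ; congr (_ + _ * _); apply: IHk; rewrite ?addSn //=.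
- by rewrite /centred /= psi1 subrr eqxx.
- exact: ltnW.
- exact: ltnW.
Qed.

End CentringReduction.

(** * The Boolean extension on words *)

Section FreeMonoid.

Variable X : choiceType.

Lemma fm1_nil : (mone : {fmonom X}) = FMonom [::].
Proof. exact: fmoneE. Qed.

Lemma fmu_seq1 (x : X) : fmu x = FMonom [:: x].
Proof. exact: fmuE. Qed.

Lemma fmul_cat (u v : {fmonom X}) : mmul u v = FMonom (u ++ v).
Proof. exact: fmmulE. Qed.

End FreeMonoid.

Section BooleanExtension.

Variables (C : numClosedFieldType) (G : bool -> choiceType) (l : bool).
Variable phi : {scalar alg C G l}.

Lemma blocks_cat_t (X : Type) (u v : seq (option X)) :
  blocks (u ++ None :: v) = blocks u ++ blocks v.
Proof.
elim: u => [|[a|] u IHu] //=; rewrite IHu //.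
by case: u {IHu} => [|[b|] u].
Qed.

Lemma blocks_map_Some (X : Type) (u : seq X) : blocks (map Some u) = [:: u].
Proof. by elim: u => //= a u ->. Qed.

(** The letter t acts as the projection onto the vacuum: it cuts a word into
    two independent factors. *)
Lemma bool_ext_word_t (u v : seq (tletter G l)) :
  bool_ext_word phi (FMonom (u ++ None :: v))
    = bool_ext_word phi (FMonom u) * bool_ext_word phi (FMonom v).
Proof. by rewrite /bool_ext_word /= blocks_cat_t big_cat. Qed.

Lemma bool_ext_word_nil : bool_ext_word phi (FMonom [::]) = 1.
Proof. by rewrite /bool_ext_word /= big_cons big_nil. Qed.

Lemma bool_ext_word_Some (w : {fmonom letter G l}) : phi 1 = 1 ->
  bool_ext_word phi (FMonom (map Some w)) = phi << w >>.
Proof.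
move=> phi1; rewrite /bool_ext_word /= blocks_map_Some big_cons big_nil.
case: w => -[|a w] /=; last by rewrite mulr1.
by rewrite -fmoneE -[LHS]phi1.
Qed.

End BooleanExtension.

(** * The tensor product, site by site *)

Section Sites.

Variables (C : numClosedFieldType) (G : bool -> choiceType).
Variables (phi psi : forall l, {scalar alg C G l}) (m : nat).
Hypothesis phi1 : forall l, phi l 1 = 1.
Hypothesis psi1 : forall l, psi l 1 = 1.

Local Notation T := (tens_alg C G m).
Local Notation K := (tens_monom G m).
Local Notation Phi := (@tens_state C G m phi psi).

Definition site (p : K) (l : bool) : 'I_m -> {fmonom tletter G l} :=
  match l with false => p.1 | true => p.2 end.

Lemma siteP (p q : K) : (forall l i, site p l i = site q l i) -> p = q.
Proof.
case: p q => [p1 p2] [q1 q2] pq.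
by congr pair; apply/ffunP=> i; [apply: (pq false) | apply: (pq true)].
Qed.

Lemma siteM (p q : K) l i :
  site (mmul p q) l i = FMonom (site p l i ++ site q l i).
Proof.
by rewrite -fmul_cat; case: l; rewrite /= ffunE.
Qed.

Definition word_at l (k : nat) : {fmonom letter G l} -> K :=
  match l with
  | false => fun w => ([ffun i : 'I_m =>
      if i == k :> nat then FMonom (map Some w) else mone], mone)
  | true => fun w => (mone, [ffun i : 'I_m =>
      if i == k :> nat then FMonom (map Some w) else mone])
  end.

Definition t_from l (k : nat) : K :=
  let u l' := [ffun i : 'I_m =>
    if (k <= i)%N then fmu (None : tletter G l') else mone] in
  if l then (mone, u true) else (u false, mone).

Lemma site_word_at l k w (i : 'I_m) :
  site (word_at k w) l i =
    if i == k :> nat then FMonom (map Some w) else FMonom [::].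
Proof.
by case: l w => w; rewrite /= ffunE fm1_nil.
Qed.

Lemma site_word_atN l l' k w (i : 'I_m) : l' != l ->
  site (@word_at l k w) l' i = FMonom [::].
Proof. by case: l l' w => -[] //= w _; rewrite ffunE fm1_nil. Qed.

Lemma site_t_from l k (i : 'I_m) :
  site (t_from l k) l i = FMonom (if (k <= i)%N then [:: None] else [::]).
Proof.
by case: l; rewrite /= ffunE fm1_nil fmu_seq1; case: ifP.
Qed.

Lemma site_t_fromN l l' k (i : 'I_m) : l' != l ->
  site (t_from l k) l' i = FMonom [::].
Proof. by case: l l' => -[] //= _; rewrite ffunE fm1_nil. Qed.

Definition site_state l (i : nat) : {scalar alg C G l} :=
  if i == 0%N then phi l else psi l.

Lemma site_state1 l i : site_state l i 1 = 1.
Proof. by rewrite /site_state; case: ifP. Qed.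

Definition site_val (p : K) l (i : 'I_m) : C :=
  bool_ext_word (site_state l i) (site p l i).

Lemma tens_stateU c p : Phi << c *g p >> = c * \prod_l \prod_i site_val p l i.
Proof.
rewrite /tens_state mmapU /= big_bool /= mulrC [in RHS]mulrC; congr (_ * _).
rewrite [RHS]mulrC; congr (_ * _); apply: eq_bigr => i _;
  rewrite /bool_ext mmapU /= mul1r /site_val /site_state /=;
  by case: (i == 0%N :> nat).
Qed.

Lemma tens_stateD x y : Phi (x + y) = Phi x + Phi y.
Proof. exact: mmapD. Qed.

Lemma tens_state0 : Phi 0 = 0.
Proof. exact: mmap0. Qed.

Lemma tens_stateZ c x : Phi (c *: x) = c * Phi x.
Proof.
elim/malg_ind: x => [|x y IHx IHy|a k].
  by rewrite scaler0 tens_state0 mulr0.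
  by rewrite scalerDr !tens_stateD IHx IHy mulrDr.
by rewrite -mul_malgC malgUM mul1m !tens_stateU mulrA.
Qed.

(** The state of a monomial is a product over the sites, so a scalar produced at
    one site factors out. *)
Lemma site_val_prod c l0 (i0 : 'I_m) (p q : K) :
  site_val p l0 i0 = c * site_val q l0 i0 ->
  (forall i, i != i0 -> site_val p l0 i = site_val q l0 i) ->
  (forall l i, l != l0 -> site_val p l i = site_val q l i) ->
  \prod_l \prod_i site_val p l i = c * \prod_l \prod_i site_val q l i.
Proof.
move=> e0 e1 e2.
rewrite (bigD1 l0) // [in RHS](bigD1 l0) //=.
rewrite (bigD1 i0) //= [in RHS](bigD1 i0) //=.
rewrite e0 -!mulrA; congr (_ * (_ * (_ * _))); first exact: eq_bigr.
by apply: eq_bigr => l l_l0; apply: eq_bigr => i _; apply: e2.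
Qed.

End Sites.

Section Sandwich.

Variables (C T : pzSemiRingType) (B : T -> Prop) (f : T -> C).
Hypothesis T_ind : forall Q : T -> Prop, Q 0 ->
  (forall x y, Q x -> Q y -> Q (x + y)) -> (forall x, B x -> Q x) ->
  forall x, Q x.
Hypothesis f0 : f 0 = 0.
Hypothesis fD : forall x y, f (x + y) = f x + f y.

(** Congruences modulo Phi are two-sided; being bilinear in the surrounding
    elements, they need only be tested on the terms that span the algebra. *)
Lemma sandwich_ext (a b : T) c :
  (forall z v, B z -> B v -> f (z * a * v) = c * f (z * b * v)) ->
  forall z v, f (z * a * v) = c * f (z * b * v).
Proof.
move=> fab; elim/T_ind => [|x y IHx IHy|z Bz] v.
- by rewrite !mul0r f0 mulr0.
- by rewrite !mulrDl !fD IHx IHy mulrDr.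
elim/T_ind: v => [|x y IHx IHy|v Bv]; last exact: fab.
- by rewrite !mulr0 f0 mulr0.
by rewrite !mulrDr !fD IHx IHy mulrDr.
Qed.

End Sandwich.

Section MonomialInduction.

Variables (C : numClosedFieldType) (K : monomType).

Definition malg_term (x : {malg C[K]}) := exists c k, x = << c *g k >>.

Lemma malg_term_ind (Q : {malg C[K]} -> Prop) : Q 0 ->
  (forall x y, Q x -> Q y -> Q (x + y)) -> (forall x, malg_term x -> Q x) ->
  forall x, Q x.
Proof.
by move=> Q0 QD QU; apply: malg_ind => // c k; apply: QU; exists c, k.
Qed.

Lemma malgUM3 (a b c : C) (p q r : K) :
  << a *g p >> * << b *g q >> * << c *g r >>
    = << a * b * c *g mmul (mmul p q) r >> :> {malg C[K]}.
Proof. by rewrite -2!malgUM. Qed.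

Lemma malgUM5 (a b c d e : C) (p q r s t : K) :
  << a *g p >> * (<< b *g q >> * << c *g r >> * << d *g s >>) * << e *g t >>
    = << a * (b * c * d) * e *g mmul (mmul p (mmul (mmul q r) s)) t >>
    :> {malg C[K]}.
Proof. by rewrite -4!malgUM. Qed.

Lemma tensBl (K' : monomType) (x y : {malg C[K]}) (z : {malg C[K']}) :
  tens (x - y) z = tens x z - tens y z.
Proof. by apply/eqP; rewrite eq_sym subr_eq -tensDl subrK. Qed.

Lemma tensBr (K' : monomType) (x y : {malg C[K]}) (z : {malg C[K']}) :
  tens z (x - y) = tens z x - tens z y.
Proof. by apply/eqP; rewrite eq_sym subr_eq -tensDr subrK. Qed.

End MonomialInduction.

(** * Words at a site and tails of t *)

Section Operators.

Variables (C : numClosedFieldType) (G : bool -> choiceType).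
Variables (phi psi : forall l, {scalar alg C G l}) (m : nat).
Hypothesis phi1 : forall l, phi l 1 = 1.
Hypothesis psi1 : forall l, psi l 1 = 1.

Local Notation T := (tens_alg C G m).
Local Notation K := (tens_monom G m).
Local Notation Phi := (@tens_state C G m phi psi).
Local Notation s_ := (site_state phi psi).

Definition at_site l k (x : alg C G l) : T :=
  if (k < m)%N then malg_ext (fun w => << word_at m k w >>) x else 0.

Definition t_tail l k : T := << t_from G m l k >>.

Lemma at_siteD l k (x y : alg C G l) :
  at_site k (x + y) = at_site k x + at_site k y.
Proof.
by rewrite /at_site; case: (k < m)%N; [exact: malg_extD | rewrite addr0].
Qed.

Lemma at_site0 l k : at_site k (0 : alg C G l) = 0.
Proof. by rewrite /at_site malg_ext0; case: (k < m)%N. Qed.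

Lemma at_siteU l k c (w : {fmonom letter G l}) : (k < m)%N ->
  at_site k << c *g w >> = << c *g word_at m k w >>.
Proof.
by move=> lt_km; rewrite /at_site lt_km malg_extU -mul_malgC malgUM mulr1 mul1m.
Qed.

Lemma at_siteM l k (x y : alg C G l) : (k < m)%N ->
  at_site k (x * y) = at_site k x * at_site k y.
Proof.
move=> lt_km; rewrite /at_site lt_km; apply: malg_extM => u v.
apply: etrans _ (esym (malgUM _ _ _ _)); rewrite mulr1; congr << _ *g _ >>.
apply: siteP => l' i; rewrite siteM; have [->|l'l] := eqVneq l' l.
  by rewrite !site_word_at; case: (i == k :> nat); rewrite // fmM map_cat.
by rewrite !site_word_atN.
Qed.

Lemma at_site1 l k : (k < m)%N -> at_site k (1 : alg C G l) = 1.
Proof.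
move=> lt_km; rewrite (at_siteU _ _ lt_km); congr << _ *g _ >>.
apply: siteP => l' i; have [->|l'l] := eqVneq l' l.
  by rewrite site_word_at fm1 if_same; case: (l); rewrite /= ffunE fm1_nil.
by rewrite site_word_atN //; case: (l'); rewrite /= ffunE fm1_nil.
Qed.

Lemma at_siteZ l k c (x : alg C G l) : at_site k (c *: x) = c *: at_site k x.
Proof.
by rewrite /at_site; case: (k < m)%N; [exact: malg_extZ | rewrite scaler0].
Qed.

Lemma tens_state1 : Phi 1 = 1.
Proof.
apply: etrans (tens_stateU phi psi 1 (mone : tens_monom G m)) _; rewrite mul1r.
apply: big1 => l _; apply: big1 => i _.
have -> : site_val phi psi (mone : tens_monom G m) l i
    = bool_ext_word (site_state phi psi l i) (FMonom [::]).
  by congr bool_ext_word; case: (l); rewrite /= ffunE fm1_nil.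
exact: bool_ext_word_nil.
Qed.

Lemma tens_stateU3 a b c (p q r : K) :
  Phi (<< a *g p >> * << b *g q >> * << c *g r >>)
    = a * b * c * \prod_l \prod_i site_val phi psi (mmul (mmul p q) r) l i.
Proof. by rewrite malgUM3 tens_stateU. Qed.

Lemma tens_stateU5 a b c d e (p q r s t : K) :
  Phi (<< a *g p >> * (<< b *g q >> * << c *g r >> * << d *g s >>)
    * << e *g t >>)
  = a * (b * c * d) * e * \prod_l \prod_i
      site_val phi psi (mmul (mmul p (mmul (mmul q r) s)) t) l i.
Proof. by rewrite malgUM5 tens_stateU. Qed.

(** Site by site: t t and t have the same effect, and at site k the word x is
    enclosed by two letters t, which isolate it as one block. *)
Lemma t_tail_compress l k i0 j0 (x : alg C G l) z v :
  (k < m)%N -> (i0 <= k)%N -> (j0 <= k)%N ->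
  Phi (z * (t_tail l i0 * at_site k x * t_tail l j0) * v)
    = s_ l k x * Phi (z * t_tail l (minn i0 j0) * v).
Proof.
move=> lt_km le_i le_j.
elim/malg_ind: x => [|x y IHx IHy|c w].
- by rewrite at_site0 !(mulr0, mul0r) raddf0 mul0r tens_state0.
- rewrite at_siteD mulrDr [in LHS]mulrDl mulrDr [in LHS]mulrDl.
  rewrite tens_stateD raddfD [in RHS]mulrDl.
  by congr (_ + _); [exact: IHx | exact: IHy].
apply: (@sandwich_ext _ _ _ Phi (@malg_term_ind _ _)
  (tens_state0 phi psi m) (@tens_stateD _ _ phi psi m)).
move=> _ _ [a [p ->]] [b [q ->]].
have -> : s_ l k << c *g w >> = c * s_ l k << w >>.
  by rewrite -[c in LHS]mulr1 -[w in LHS]mul1m -malgUM mul_malgC linearZ.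
rewrite (at_siteU _ _ lt_km) /t_tail.
apply: etrans (tens_stateU5 _ _ _ _ _ _ _ _ _ _) _.
apply: etrans (congr1 _ (esym (tens_stateU3 _ _ _ _ _ _))).
rewrite !mul1r !mulr1.
rewrite (@site_val_prod _ _ _ _ _ (s_ l k << w >>) l (Ordinal lt_km)
  _ (mmul (mmul p (t_from G m l (minn i0 j0))) q)).
- ring.
- rewrite /site_val !siteM !site_t_from site_word_at /= eqxx le_i le_j.
  rewrite geq_min le_i /= -!catA /= bool_ext_word_t bool_ext_word_t.
  rewrite -catA bool_ext_word_t bool_ext_word_Some.
    by rewrite mulrCA.
  exact: site_state1.
- move=> i ne_ik; rewrite /site_val !siteM !site_t_from site_word_at /=.
  have /negbTE -> : i != k :> nat.
    by apply: contra ne_ik => /eqP ik; apply/eqP/val_inj.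
  rewrite /= cats0 geq_min; case: (i0 <= i)%N; case: (j0 <= i)%N => //=;
    rewrite ?cats0 -?catA //=.
  (* Between two adjacent letters t there is an empty block. *)
  rewrite !bool_ext_word_t (@bool_ext_word_t _ _ _ _ [::]).
  by rewrite bool_ext_word_nil mul1r.
- by move=> l' i l'l; rewrite /site_val !siteM !site_t_fromN ?site_word_atN.
Qed.

Lemma tens_state_t_tail_l l k v : Phi (t_tail l k * v) = Phi v.
Proof.
elim/malg_ind: v => [|x y IHx IHy|c p]; first by rewrite mulr0.
  rewrite mulrDr !tens_stateD.
  by congr (_ + _); [exact: IHx | exact: IHy].
apply: etrans (congr1 _ (malgUM _ _ _ _)) _.
apply: etrans (tens_stateU _ _ _ _) _.
apply: etrans (esym (tens_stateU _ _ _ _)); rewrite mul1r; congr (_ * _).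
apply: eq_bigr => l' _; apply: eq_bigr => i _; rewrite /site_val siteM.
have [->|l'l] := eqVneq l' l; last first.
  by rewrite site_t_fromN //=; case: (site _ _ _).
rewrite site_t_from /=; case: (k <= i)%N => /=; last by case: (site _ _ _).
rewrite (@bool_ext_word_t _ _ _ _ [::]) bool_ext_word_nil mul1r.
by case: (site _ _ _).
Qed.

Lemma tens_state_t_tail_r l k v : Phi (v * t_tail l k) = Phi v.
Proof.
elim/malg_ind: v => [|x y IHx IHy|c p]; first by rewrite mul0r.
  rewrite mulrDl !tens_stateD.
  by congr (_ + _); [exact: IHx | exact: IHy].
apply: etrans (congr1 _ (malgUM _ _ _ _)) _.
apply: etrans (tens_stateU _ _ _ _) _.
apply: etrans (esym (tens_stateU _ _ _ _)); rewrite mulr1; congr (_ * _).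
apply: eq_bigr => l' _; apply: eq_bigr => i _; rewrite /site_val siteM.
have [->|l'l] := eqVneq l' l; last first.
  by rewrite site_t_fromN //= cats0; case: (site _ _ _).
rewrite site_t_from /=; case: (k <= i)%N => /=; last first.
  by rewrite cats0; case: (site _ _ _).
rewrite bool_ext_word_t bool_ext_word_nil mulr1.
by case: (site _ _ _).
Qed.

Lemma at_site_t_tail_comm l l' k k' (x : alg C G l) : (l' != l) || (k < k')%N ->
  at_site k x * t_tail l' k' = t_tail l' k' * at_site k x.
Proof.
move=> l'l_or_lt.
have [lt_km|le_mk] := ltnP k m; last first.
  by rewrite /at_site ltnNge le_mk mul0r mulr0.
elim/malg_ind: x => [|x y IHx IHy|c w]; first by rewrite at_site0 mul0r mulr0.
  rewrite at_siteD; apply: etrans (mulrDl _ _ _) _.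
  by apply: etrans (esym (mulrDr _ _ _)); exact: (congr2 +%R IHx IHy).
rewrite (at_siteU _ _ lt_km); apply: etrans (malgUM _ _ _ _) _.
apply: etrans (esym (malgUM _ _ _ _)); rewrite mulr1 mul1r; congr << _ *g _ >>.
apply: siteP => l0 i; rewrite !siteM.
have [->|l0l'] := eqVneq l0 l'; last by rewrite site_t_fromN // cats0.
have [l'l|l'l] := eqVneq l' l; last by rewrite site_word_atN // cats0.
rewrite l'l eqxx /= in l'l_or_lt *; rewrite site_word_at site_t_from.
have [ik|_] := eqVneq (i : nat) k; last by rewrite cats0.
by rewrite leqNgt ik l'l_or_lt /= cats0.
Qed.

Lemma tens_letter1 k k' (a : letter G false) :
  tens (tens_incl m k.+1 (talg_letter C a)) (tens_t C G true m k'.+1)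
    = at_site k << fmu a >> * t_tail true k'.
Proof.
rewrite /tens_incl /at_site; have [lt_km|_] := ltnP k m; last first.
  by rewrite tens0l mul0r.
rewrite /talg_letter !malg_extU !scale1r; apply: etrans (tensUU _ _ _ _) _.
apply: etrans (esym (malgUM _ _ _ _)); congr << _ *g _ >>.
apply: siteP => -[] i; rewrite siteM.
  rewrite site_t_from site_word_atN //= ffunE ltnS.
  by case: ifP; rewrite ?fmu_seq1 ?fm1_nil.
rewrite site_t_fromN // site_word_at /= ffunE eqSS cats0.
by case: ifP; rewrite ?fmu_seq1 ?fm1_nil.
Qed.

Lemma tens_letter2 k k' (a : letter G true) :
  tens (tens_t C G false m k'.+1) (tens_incl m k.+1 (talg_letter C a))
    = at_site k << fmu a >> * t_tail false k'.
Proof.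
rewrite /tens_incl /at_site; have [lt_km|_] := ltnP k m; last first.
  by rewrite tens0r mul0r.
rewrite /talg_letter !malg_extU !scale1r; apply: etrans (tensUU _ _ _ _) _.
apply: etrans (esym (malgUM _ _ _ _)); congr << _ *g _ >>.
apply: siteP => -[] i; rewrite siteM.
  rewrite site_t_fromN // site_word_at /= ffunE eqSS cats0.
  by case: ifP; rewrite ?fmu_seq1 ?fm1_nil.
rewrite site_t_from site_word_atN //= ffunE ltnS.
by case: ifP; rewrite ?fmu_seq1 ?fm1_nil.
Qed.

Lemma j_letterE l (a : letter G l) :
  j_letter C m (Tagged (letter G) a)
    = \sum_(0 <= k < m)
        (at_site k << fmu a >> - at_site k.+1 << fmu a >>) * t_tail (~~ l) k.
Proof.
case: l a => a; rewrite /= /j1 /j2 big_add1 /=; apply: eq_bigr => k _.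
  apply: etrans (tensBr _ _ _) _; apply: etrans _ (esym (mulrBl _ _ _)).
  exact: (congr2 (fun u v => u - v) (tens_letter2 _ _ _) (tens_letter2 _ _ _)).
apply: etrans (tensBl _ _ _) _; apply: etrans _ (esym (mulrBl _ _ _)).
exact: (congr2 (fun u v => u - v) (tens_letter1 _ _ _) (tens_letter1 _ _ _)).
Qed.

End Operators.

(** * The value on centred products, and the theorem *)

Section Inclusion.

Variables (C : numClosedFieldType) (G : bool -> choiceType).

Lemma alg_word_ind l (Q : alg C G l -> Prop) : Q 1 ->
  (forall a, Q << fmu a >>) -> (forall x y, Q x -> Q y -> Q (x * y)) ->
  (forall x y, Q x -> Q y -> Q (x + y)) ->
  (forall c x, Q x -> Q (c *: x)) -> forall x, Q x.
Proof.
move=> Q1 Qgen QM QD QZ; apply: malg_ind => [||c [s]].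
- by rewrite -(scale0r 1); apply: QZ.
- exact: QD.
rewrite -[c]mulr1 -[FMonom s]mul1m -malgUM mul_malgC; apply: QZ.
elim: s => [|a s IHs]; first by rewrite -fm1_nil.
have -> : FMonom (a :: s) = mmul (fmu a) (FMonom s).
  by rewrite fmul_cat fmu_seq1.
by rewrite -[1]mulr1 -malgUM; apply: QM.
Qed.

Lemma incl1 l : incl (1 : alg C G l) = 1.
Proof. by rewrite /incl malg_extU scale1r fm1 -fm1_nil. Qed.

Lemma inclM l : {morph @incl C G l : x y / x * y}.
Proof.
by apply: malg_extM => u v; rewrite malgUM mulr1 fmM map_cat fmul_cat.
Qed.

Lemma inclD l (x y : alg C G l) : incl (x + y) = incl x + incl y.
Proof. exact: malg_extD. Qed.

Lemma inclZ l c (x : alg C G l) : incl (c *: x) = c *: incl x.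
Proof. exact: malg_extZ. Qed.

Lemma incl_fmu l (a : letter G l) :
  incl << fmu a >> = << fmu (Tagged (letter G) a) >> :> falg C G.
Proof. by rewrite /incl malg_extU scale1r fmU fmu_seq1. Qed.

End Inclusion.

Section Main.

Variables (C : numClosedFieldType) (G : bool -> choiceType).
Variables (phi psi : forall l, {scalar alg C G l}) (m : nat).
Hypothesis phi1 : forall l, phi l 1 = 1.
Hypothesis psi1 : forall l, psi l 1 = 1.

Local Notation Phi := (@tens_state C G m phi psi).
Local Notation j := (@j C G m).

Lemma Phi_centred (s : seq {l : bool & alg C G l}) :
  alternating_sides s ->
  all (fun x => psi (tag x) (tagged x) == 0) s -> (size s <= 2 * m)%N ->
  Phi (j (\prod_(x <- s) incl (tagged x)))
    = \prod_(x <- s) phi (tag x) (tagged x).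
Proof.
move=> alt_s cs le_s.
have -> : j (\prod_(x <- s) incl (tagged x))
    = \prod_(x <- s) j (incl (tagged x)).
  exact: (big_morph j (@jM C G m) (j1E C G m)).
apply: (@Phi_factor_prod_centred C (tens_alg C G m) (fun l => alg C G l)
  (letter G)
  (fun l a => << fmu a >>) m Phi (fun l k => t_tail C G m l k)
  (fun l k x => at_site m k x)
  (fun l x => j (incl x)) (fun l => phi l) (fun l => psi l)).
- exact: malg_mulZr.
- exact: alg_word_ind.
- exact: tens_stateD.
- exact: tens_stateZ.
- exact: tens_state1.
- exact: tens_state_t_tail_l.
- exact: tens_state_t_tail_r.
- by move=> l; rewrite incl1; exact: j1E.
- by move=> l x y; rewrite inclM; exact: jM.
- by move=> l x y; rewrite inclD; exact: jD.
- by move=> l c x; rewrite inclZ; exact: jZ.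
- exact: at_site1.
- exact: at_siteM.
- exact: at_siteD.
- exact: at_siteZ.
- by move=> l x; rewrite /at_site ltnn.
- move=> l a; apply: etrans _ (@j_letterE C G m l a).
  by rewrite incl_fmu /j malg_extU scale1r fmU big_seq1.
- exact: at_site_t_tail_comm.
- move=> l k i0 j0 x z v lt_km le_i le_j.
  apply: etrans (t_tail_compress _ _ _ _ _ lt_km le_i le_j) _ => //.
  by congr (_ * _); rewrite /site_state; case: eqP.
- exact: alt_s.
- exact: cs.
exact: le_s.
Qed.

End Main.

Section CondFree.

Variables (C : numClosedFieldType) (G : bool -> choiceType).
Variables (phi psi : forall l, alg C G l -> C) (chi : {scalar falg C G}).
Hypothesis chi_cfree : cond_free_product phi psi chi.

Lemma chi_centred (s : seq {l : bool & alg C G l}) :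
  alternating_sides s ->
  all (fun x => psi (tagged x) == 0) s ->
  chi (\prod_(x <- s) incl (tagged x)) = \prod_(x <- s) phi (tagged x).
Proof.
case: chi_cfree => _ chi_prod alt_s cs.
pose x0 : {l : bool & alg C G l} :=
  existT (fun l => alg C G l) true (0 : alg C G true).
rewrite !(big_nth x0) !big_mkord.
apply: (chi_prod _ (fun i => tag (nth x0 s i)) (fun i => tagged (nth x0 s i))).
  move=> i i' def_i'; have := sortedP true alt_s i.
  by rewrite size_map -def_i' => /(_ (ltn_ord i')); rewrite !(nth_map x0).
by move=> i; apply/eqP/(allP cs)/mem_nth.
Qed.

End CondFree.

Theorem theorem4p1 (R : realType) (G : bool -> choiceType)
    (phi psi : forall l : bool, {scalar alg R[i] G l})
    (phi_state : forall l, is_state (@alg_star _ G l) (phi l))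
    (psi_state : forall l, is_state (@alg_star _ G l) (psi l))
    (chi : {scalar falg R[i] G}) (chi_cfree : cond_free_product phi psi chi)
    (m n : nat) (m_gt0 : (0 < m)%N) (le_n_2m : (n <= 2 * m)%N)
    (k : 'I_n -> bool) (k_alt : alternating k)
    (w : forall i : 'I_n, {fmonom letter G (k i)}) :
  (tens_state phi psi \o j m) (\prod_(i < n) incl << w i >>)
    = chi (\prod_(i < n) incl << w i >>).
Proof.
pose s := [seq existT (fun l => alg R[i] G l) (k i) << w i >>
             | i <- index_enum 'I_n].
have -> : \prod_(i < n) incl << w i >>
    = \prod_(x <- s) incl (tagged x) :> falg R[i] G.
  by rewrite big_map.
have phi1 l : phi l 1 = 1 by case: (phi_state l).
have psi1 l : psi l 1 = 1 by case: (psi_state l).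
apply: (@eq_on_products R[i] (falg R[i] G) (fun l => alg R[i] G l)
  (fun l x => incl x) (fun l => psi l) _ _ _ _ _
  (tens_state phi psi \o j m) chi (2 * m)%N).
- exact: malg_mulZr.
- exact: inclM.
- exact: inclD.
- by move=> l c; rewrite inclZ incl1.
- by move=> l c x; rewrite raddfB /= linearZ /= psi1 mulr1.
- by move=> x y; rewrite /= jD; exact: tens_stateD.
- by move=> c x; rewrite /= jZ; exact: tens_stateZ.
- exact: raddfD.
- by move=> c x; rewrite linearZ.
- move=> t alt_t ct le_t.
  apply: etrans (Phi_centred phi1 psi1 alt_t ct le_t) _.
  exact/esym/(chi_centred chi_cfree alt_t ct).
by rewrite size_map /index_enum unlock -enumT size_enum_ord.
Qed.
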